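(* Let $a\in\mathbf{C}$ and $\delta\in\mathbf{C}$. For the transposed Poisson algebra $\mathcal{W}(a,-1)$, and likewise for the induced transposed Poisson structure on the Witt algebra $\mathbf{W}$, non-trivial $\delta$-derivations exist only for $\delta=1$ or $\delta=\frac12$.
   Context: All algebras are over $\mathbf{C}$. For $a\in\mathbf{C}$, the transposed Poisson algebra $\mathcal{W}(a,-1)$ is the vector space with basis $\{L_n,I_m\mid n,m\in\mathbf{Z}\}$, with commutative associative product $L_n\cdot L_m=L_{n+m}$, $L_n\cdot I_m=I_{n+m}$, $I_n\cdot I_m=0$, and Lie bracket $[L_n,L_m]=(n-m)L_{n+m}$, $[L_n,I_m]=-(m+a-n)I_{n+m}$, $[I_n,I_m]=0$. The Witt algebra $\mathbf{W}$ is the span of the $L_n$, with the induced products $L_n\cdot L_m=L_{n+m}$, $[L_n,L_m]=(n-m)L_{n+m}$. A $\delta$-derivation is a linear map $D$ satisfying $D(x\star y)=\delta\bigl(D(x)\star y+x\star D(y)\bigr)$ for all $x,y$ and for both products $\star\in\{\cdot,[\ ,\ ]\}$. Non-trivial means nonzero. *)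

(* Defs.v *)
From HB Require Import structures.
From mathcomp Require Import all_boot all_order all_algebra.
From mathcomp Require Import finmap monalg reals complex ring.

Set Implicit Arguments.
Unset Strict Implicit.
Unset Printing Implicit Defensive.

Import Order.TTheory GRing.Theory Num.Theory.

Local Open Scope ring_scope.

Section Bilinear.
Variables (K : fieldType) (U V W : lmodType K).

Definition bilinear_op (b : U -> V -> W) : Prop :=
  (forall y, linear (b^~ y)) /\ (forall x, linear (b x)).

End Bilinear.

Record transposedPoissonAlg (K : fieldType) := TransposedPoissonAlg {
  tp_carrier :> lmodType K;
  tp_mul : tp_carrier -> tp_carrier -> tp_carrier;
  tp_br : tp_carrier -> tp_carrier -> tp_carrier;
  tp_mul_bilinear : bilinear_op tp_mul;
  tp_mulC : commutative tp_mul;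
  tp_mulA : associative tp_mul;
  tp_br_bilinear : bilinear_op tp_br;
  tp_br_alt : forall x, tp_br x x = 0;
  tp_br_jacobi : forall x y z,
    tp_br x (tp_br y z) + tp_br y (tp_br z x) + tp_br z (tp_br x y) = 0;
  tp_br_transposed : forall x y z,
    2%:R *: tp_mul z (tp_br x y) =
      tp_br (tp_mul z x) y + tp_br x (tp_mul z y)
}.

Definition delta_derivation (K : fieldType) (A : transposedPoissonAlg K) (delta : K)
    (D : {linear A -> A}) : Prop :=
  (forall x y : A,
     D (tp_mul x y) = delta *: (tp_mul (D x) y + tp_mul x (D y))) /\
  (forall x y : A,
     D (tp_br x y) = delta *: (tp_br (D x) y + tp_br x (D y))).

Definition nontrivial (K : fieldType) (A : transposedPoissonAlg K) (D : {linear A -> A}) :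
  Prop := exists x : A, D x <> 0.

(* {malg K[B]} is the vector space with basis B, and << k >> is the basis     *)
(* vector attached to k : B.                                                  *)
Section Extension.
Variables (K : fieldType) (B : choiceType) (V : lmodType K).

Definition lin_ext (f : B -> V) (x : {malg K[B]}) : V :=
  \sum_(k <- msupp x) x@_k *: f k.

Definition bilin_ext (B' : choiceType) (m : B -> B' -> V)
    (x : {malg K[B]}) (y : {malg K[B']}) : V :=
  \sum_(i <- msupp x) \sum_(j <- msupp y) (x@_i * y@_j) *: m i j.

Lemma lin_extEw (d : {fset B}) (f : B -> V) (x : {malg K[B]}) :
  fsubset (msupp x) d -> lin_ext f x = \sum_(k <- d) x@_k *: f k.
Proof.
move=> le; rewrite /lin_ext (big_fset_incl _ le) // => k _ kx.
by rewrite mcoeff_outdom // scale0r.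
Qed.

Lemma lin_ext_linear f : linear (lin_ext f).
Proof.
move=> c x y; set d := fsetU (msupp x) (msupp y).
rewrite !(@lin_extEw d) ?fsubsetUl ?fsubsetUr //; last first.
  apply: (fsubset_trans (msuppD_le _ _)).
  by apply: fsetUSS => //; exact: msuppZ_le.
rewrite scaler_sumr -big_split; apply: eq_bigr => k _.
by rewrite mcoeffD mcoeffZ scalerDl scalerA.
Qed.

Lemma lin_extU f k : lin_ext f << k >> = f k.
Proof. by rewrite /lin_ext msuppU oner_eq0 big_seq_fset1 mcoeffUU scale1r. Qed.

Lemma linear_ext (F G : {malg K[B]} -> V) : linear F -> linear G ->
  (forall k, F << k >> = G << k >>) -> F =1 G.
Proof.
move=> lF lG FG x; rewrite (monalgE x).
have F0 H : linear H -> H (0 : {malg K[B]}) = 0 :> V.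
  move=> lH; have := lH 1 0 0; rewrite !scale1r addr0 => /eqP.
  by rewrite -subr_eq subrr => /eqP <-.
elim: (X in \sum_(k <- X) _) => [|k s IH]; first by rewrite big_nil !F0.
rewrite big_cons -[x@_k]mulr1.
have -> : << x@_k * 1 *g k >> = x@_k *: << k >> :> {malg K[B]}.
  by apply/malgP => l; rewrite mcoeffZ !mcoeffU mulrnAr.
by rewrite lF lG FG IH.
Qed.

End Extension.

Section BilinExt.
Variables (K : fieldType) (B : choiceType).
Implicit Types (V : lmodType K).
Local Notation M := {malg K[B]}.

Lemma bilin_extE V (m : B -> B -> V) (x y : M) :
  bilin_ext m x y = lin_ext (fun i => lin_ext (m i) y) x.
Proof.
apply: eq_bigr => i _; rewrite scaler_sumr.
by apply: eq_bigr => j _; rewrite scalerA.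
Qed.

Lemma bilin_ext_bilinear V (m : B -> B -> V) : bilinear_op (bilin_ext m).
Proof.
split=> x c u v; rewrite !bilin_extE; first exact: lin_ext_linear.
rewrite /lin_ext scaler_sumr -big_split; apply: eq_bigr => i _ /=.
rewrite -!/(lin_ext _ _) lin_ext_linear scalerDr !scalerA.
by rewrite [c * _]mulrC.
Qed.

Lemma bilin_extU V (m : B -> B -> V) i j :
  bilin_ext m << i >> << j >> = m i j.
Proof. by rewrite bilin_extE !lin_extU. Qed.

Lemma bilinear_ext V (F G : M -> M -> V) : bilinear_op F -> bilinear_op G ->
  (forall i j, F << i >> << j >> = G << i >> << j >>) -> forall x y, F x y = G x y.
Proof.
move=> [Fl Fr] [Gl Gr] FG x y.
apply: (linear_ext (Fl y) (Gl y)) => i.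
exact: (linear_ext (Fr _) (Gr _)).
Qed.

Definition trilinear_op V (F : M -> M -> M -> V) :=
  (forall x, bilinear_op (F x)) /\ (forall y z, linear (F^~ y ^~ z)).

Lemma trilinear_ext V (F G : M -> M -> M -> V) :
  trilinear_op F -> trilinear_op G ->
  (forall i j k, F << i >> << j >> << k >> = G << i >> << j >> << k >>) ->
  forall x y z, F x y z = G x y z.
Proof.
move=> [F1 F2] [G1 G2] FG x y z.
apply: (linear_ext (F2 y z) (G2 y z)) => i.
exact: (bilinear_ext (F1 _) (G1 _)).
Qed.

Lemma trilinear_eq0 V (F : M -> M -> M -> V) : trilinear_op F ->
  (forall i j k, F << i >> << j >> << k >> = 0) -> forall x y z, F x y z = 0.
Proof.
move=> Ftri F0; apply: (trilinear_ext (G := fun _ _ _ => 0)) => //.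
by split=> [x|x y]; [split=> y|] => k u v; rewrite scaler0 addr0.
Qed.

End BilinExt.

Section BilinearTheory.
Variables (K : fieldType) (V : lmodType K) (b : V -> V -> V).
Hypothesis bb : bilinear_op b.

Lemma bilDl c x y z : b (c *: x + y) z = c *: b x z + b y z.
Proof. exact: bb.1. Qed.
Lemma bilDr c x y z : b z (c *: x + y) = c *: b z x + b z y.
Proof. exact: bb.2. Qed.
Lemma bil0l z : b 0 z = 0.
Proof.
have /eqP := bilDl 1 0 0 z; rewrite !scale1r addr0.
by rewrite -subr_eq subrr => /eqP <-.
Qed.
Lemma bil0r z : b z 0 = 0.
Proof.
have /eqP := bilDr 1 0 0 z; rewrite !scale1r addr0.
by rewrite -subr_eq subrr => /eqP <-.
Qed.
Lemma bilZl c x z : b (c *: x) z = c *: b x z.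
Proof. by have := bilDl c x 0 z; rewrite !addr0 bil0l addr0. Qed.
Lemma bilZr c x z : b z (c *: x) = c *: b z x.
Proof. by have := bilDr c x 0 z; rewrite !addr0 bil0r addr0. Qed.

End BilinearTheory.

Section Algebras.
Variable C : numFieldType.

Definition witt_mul_basis (n m : int) : {malg C[int]} := << n + m >>.

Definition witt_br_basis (n m : int) : {malg C[int]} :=
  (n - m)%:~R *: << n + m >>.

(* The basis index inl n stands for L_n and inr m stands for I_m.             *)
Definition wbasis : choiceType := (int + int)%type.

Definition Wa_mul_basis (u v : wbasis) : {malg C[wbasis]} :=
  match u, v with
  | inl n, inl m => << (inl (n + m) : wbasis) >>
  | inl n, inr m => << (inr (n + m) : wbasis) >>
  | inr m, inl n => << (inr (n + m) : wbasis) >>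
  | inr _, inr _ => 0
  end.

Definition Wa_br_basis (a : C) (u v : wbasis) : {malg C[wbasis]} :=
  match u, v with
  | inl n, inl m => (n - m)%:~R *: << (inl (n + m) : wbasis) >>
  | inl n, inr m => - (m%:~R + a - n%:~R) *: << (inr (n + m) : wbasis) >>
  | inr m, inl n => (m%:~R + a - n%:~R) *: << (inr (n + m) : wbasis) >>
  | inr _, inr _ => 0
  end.

Definition witt_mul := bilin_ext witt_mul_basis.
Definition witt_br := bilin_ext witt_br_basis.
Definition Wa_mul := bilin_ext Wa_mul_basis.
Definition Wa_br (a : C) := bilin_ext (Wa_br_basis a).

Lemma transposed_Poisson_from_basis (B : choiceType)
    (mul br : {malg C[B]} -> {malg C[B]} -> {malg C[B]}) :
  bilinear_op mul -> bilinear_op br ->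
  (forall i j, mul << i >> << j >> = mul << j >> << i >>) ->
  (forall i j k, mul << i >> (mul << j >> << k >>) =
                 mul (mul << i >> << j >>) << k >>) ->
  (forall i j, br << i >> << j >> = - br << j >> << i >>) ->
  (forall i j k, br << i >> (br << j >> << k >>) +
                 br << j >> (br << k >> << i >>) +
                 br << k >> (br << i >> << j >>) = 0) ->
  (forall i j k, 2%:R *: mul << k >> (br << i >> << j >>) =
     br (mul << k >> << i >>) << j >> + br << i >> (mul << k >> << j >>)) ->
  [/\ commutative mul, associative mul, forall x, br x x = 0,
      forall x y z, br x (br y z) + br y (br z x) + br z (br x y) = 0
    & forall x y z, 2%:R *: mul z (br x y) = br (mul z x) y + br x (mul z y)].
Proof.
move=> mb cb mC mA cC cJ cT.
have lE := (bilDl mb, bilDr mb, bilDl cb, bilDr cb).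
have nE (k : C) (x y : {malg C[B]}) : - (k *: x + y) = k *: (- x) - y.
  by rewrite opprD scalerN.
have sE (k l : C) (x y : {malg C[B]}) :
    l *: (k *: x + y) = k *: (l *: x) + l *: y.
  by rewrite scalerDr !scalerA [l * k]mulrC.
have dE (k : C) (x y z t : {malg C[B]}) :
    (k *: x + y) + (k *: z + t) = k *: (x + z) + (y + t).
  by rewrite addrACA scalerDr.
split.
- apply: (bilinear_ext (F := mul) (G := fun x y => mul y x)) => //.
  by split=> x k u v; rewrite !lE.
- apply: (trilinear_ext (F := fun x y z => mul x (mul y z))
                        (G := fun x y z => mul (mul x y) z)) => //.
  + by split=> [x|x y]; [split=> y|] => k u v; rewrite !lE.
  + by split=> [x|x y]; [split=> y|] => k u v; rewrite !lE.
- have brC x y : br x y = - br y x.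
    move: x y.
    apply: (bilinear_ext (F := br) (G := fun x y => - br y x)) => //.
    by split=> x k u v; rewrite !lE nE.
  move=> x; have e0 : 2%:R *: br x x = 0.
    by rewrite scaler_nat mulr2n {1}brC addNr.
  by have /eqP := e0; rewrite scaler_eq0 pnatr_eq0 /= => /eqP.
- apply: (@trilinear_eq0 _ _ _
    (fun x y z => br x (br y z) + br y (br z x) + br z (br x y)) _ cJ).
  split=> [x|x y].
    split=> y k u v.
      by rewrite !lE 2!dE.
    by rewrite !lE 2!dE.
  by move=> k u v; rewrite !lE 2!dE.
- apply: (trilinear_ext (F := fun x y z => 2%:R *: mul z (br x y))
    (G := fun x y z => br (mul z x) y + br x (mul z y))) => //.
  + by split=> [x|x y]; [split=> y|] => k u v; rewrite !lE sE.
  + by split=> [x|x y]; [split=> y|] => k u v; rewrite !lE dE.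
Qed.

Lemma witt_mul_bilinear : bilinear_op witt_mul.
Proof. exact: bilin_ext_bilinear. Qed.

Lemma witt_br_bilinear : bilinear_op witt_br.
Proof. exact: bilin_ext_bilinear. Qed.

Lemma witt_mulU n m : witt_mul << n >> << m >> = << n + m >>.
Proof. exact: bilin_extU. Qed.

Lemma witt_brU n m : witt_br << n >> << m >> = (n - m)%:~R *: << n + m >>.
Proof. exact: bilin_extU. Qed.

Lemma Wa_mul_bilinear : bilinear_op Wa_mul.
Proof. exact: bilin_ext_bilinear. Qed.

Lemma Wa_br_bilinear a : bilinear_op (Wa_br a).
Proof. exact: bilin_ext_bilinear. Qed.

Lemma Wa_mulU u v : Wa_mul << u >> << v >> = Wa_mul_basis u v.
Proof. exact: bilin_extU. Qed.

Lemma Wa_brU a u v : Wa_br a << u >> << v >> = Wa_br_basis a u v.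
Proof. exact: bilin_extU. Qed.

Lemma scale_basis (B : choiceType) (c1 c2 : C) (l1 l2 : B) : c1 = c2 ->
  l1 = l2 -> c1 *: << l1 >> = c2 *: << l2 >> :> {malg C[B]}.
Proof. by move=> -> ->. Qed.

Lemma scale_basisD (B : choiceType) (c1 c2 c3 : C) (l1 l2 l3 : B) :
  c1 = c2 + c3 -> l2 = l1 -> l3 = l1 ->
  c1 *: << l1 >> = c2 *: << l2 >> + c3 *: << l3 >> :> {malg C[B]}.
Proof. by move=> -> -> ->; rewrite scalerDl. Qed.

Lemma scale_basis_eq0 (B : choiceType) (c1 c2 c3 : C) (l1 l2 l3 : B) :
  c1 + c2 + c3 = 0 -> l2 = l1 -> l3 = l1 ->
  c1 *: << l1 >> + c2 *: << l2 >> + c3 *: << l3 >> = 0 :> {malg C[B]}.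
Proof. by move=> e -> ->; rewrite -!scalerDl e scale0r. Qed.

Lemma rot1 (i j k : int) : j + (k + i) = i + (j + k).
Proof. by rewrite addrA addrC. Qed.

Lemma rot2 (i j k : int) : k + (i + j) = i + (j + k).
Proof. by rewrite addrC addrA. Qed.

Lemma witt_transposed_Poisson :
  [/\ commutative witt_mul, associative witt_mul, forall x, witt_br x x = 0,
      forall x y z, witt_br x (witt_br y z) + witt_br y (witt_br z x)
                    + witt_br z (witt_br x y) = 0
    & forall x y z, 2%:R *: witt_mul z (witt_br x y) =
                    witt_br (witt_mul z x) y + witt_br x (witt_mul z y)].
Proof.
have E := (bilZl witt_mul_bilinear, bilZr witt_mul_bilinear,
  bilZl witt_br_bilinear, bilZr witt_br_bilinear, witt_mulU, witt_brU, scalerA).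
apply: (transposed_Poisson_from_basis witt_mul_bilinear witt_br_bilinear)
  => [i j|i j k|i j|i j k|i j k]; rewrite !E.
- by rewrite addrC.
- by rewrite addrA.
- by rewrite -scaleNr -mulrNz opprB [j + i]addrC.
- apply: scale_basis_eq0; [|exact: rot1|exact: rot2].
  by rewrite !(intrB, intrD); ring.
- apply: scale_basisD; [|exact: esym (addrA _ _ _)|exact: addrCA].
  by rewrite !(intrB, intrD); ring.
Qed.

Local Ltac ring_int :=
  match goal with |- ?x = ?y => change (@eq int x y) end; ring.
Local Ltac ring_index := congr (_ _); ring_int.
Local Ltac ring_coef := rewrite ?(intrB, intrD); ring.

Lemma Wa_transposed_Poisson (a : C) :
  [/\ commutative Wa_mul, associative Wa_mul, forall x, Wa_br a x x = 0,
      forall x y z, Wa_br a x (Wa_br a y z) + Wa_br a y (Wa_br a z x)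
                    + Wa_br a z (Wa_br a x y) = 0
    & forall x y z, 2%:R *: Wa_mul z (Wa_br a x y) =
                    Wa_br a (Wa_mul z x) y + Wa_br a x (Wa_mul z y)].
Proof.
have E := (bilZl Wa_mul_bilinear, bilZr Wa_mul_bilinear,
  bil0l Wa_mul_bilinear, bil0r Wa_mul_bilinear,
  bilZl (Wa_br_bilinear a), bilZr (Wa_br_bilinear a),
  bil0l (Wa_br_bilinear a), bil0r (Wa_br_bilinear a),
  Wa_mulU, Wa_brU, scaler0, addr0, add0r, scalerA).
apply: (transposed_Poisson_from_basis Wa_mul_bilinear (Wa_br_bilinear a)).
- by move=> [i|i] [j|j]; rewrite !E //= addrC.
- move=> [i|i] [j|j] [k|k]; rewrite !E /= ?E //=; congr << _ _ >>;
    by ring_int.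
- move=> [i|i] [j|j]; rewrite !E /= -?scaleNr ?oppr0 //;
    by apply: scale_basis; [ring_coef | ring_index].
- move=> [i|i] [j|j] [k|k]; rewrite !E /= ?E /= ?E //;
    by apply: scale_basis_eq0; [ring_coef | ring_index | ring_index].
- move=> [i|i] [j|j] [k|k]; rewrite !E /= ?E /= ?E //;
    by apply: scale_basisD; [ring_coef | ring_index | ring_index].
Qed.

Definition witt : transposedPoissonAlg C :=
  TransposedPoissonAlg witt_mul_bilinear
    (let: And5 h _ _ _ _ := witt_transposed_Poisson in h)
    (let: And5 _ h _ _ _ := witt_transposed_Poisson in h)
    witt_br_bilinear
    (let: And5 _ _ h _ _ := witt_transposed_Poisson in h)
    (let: And5 _ _ _ h _ := witt_transposed_Poisson in h)
    (let: And5 _ _ _ _ h := witt_transposed_Poisson in h).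

Definition W_minus1 (a : C) : transposedPoissonAlg C :=
  TransposedPoissonAlg Wa_mul_bilinear
    (let: And5 h _ _ _ _ := Wa_transposed_Poisson a in h)
    (let: And5 _ h _ _ _ := Wa_transposed_Poisson a in h)
    (Wa_br_bilinear a)
    (let: And5 _ _ h _ _ := Wa_transposed_Poisson a in h)
    (let: And5 _ _ _ h _ := Wa_transposed_Poisson a in h)
    (let: And5 _ _ _ _ h := Wa_transposed_Poisson a in h).

(* The operations of the Witt algebra are those induced from W(a, -1) on the  *)
(* span of the L_n.                                                           *)
Definition witt_incl : {malg C[int]} -> {malg C[wbasis]} :=
  lin_ext (fun n => << (inl n : wbasis) >>).

Lemma witt_incl_induced (a : C) x y :
  witt_incl (witt_mul x y) = Wa_mul (witt_incl x) (witt_incl y) /\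
  witt_incl (witt_br x y) = Wa_br a (witt_incl x) (witt_incl y).
Proof.
have il : linear witt_incl by exact: lin_ext_linear.
have iU n : witt_incl << n >> = << (inl n : wbasis) >> by exact: lin_extU.
have i0 : witt_incl 0 = 0 by rewrite /witt_incl /lin_ext msupp0 big_seq_fset0.
have iZ c u : witt_incl (c *: u) = c *: witt_incl u.
  by have := il c u 0; rewrite i0 !addr0.
have D := (bilDl witt_mul_bilinear, bilDr witt_mul_bilinear,
  bilDl witt_br_bilinear, bilDr witt_br_bilinear,
  bilDl Wa_mul_bilinear, bilDr Wa_mul_bilinear,
  bilDl (Wa_br_bilinear a), bilDr (Wa_br_bilinear a), il).
split; move: x y.
- apply: (bilinear_ext (F := fun x y => witt_incl (witt_mul x y))
    (G := fun x y => Wa_mul (witt_incl x) (witt_incl y))) => [||n m].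
  + by split=> z c u v; rewrite !D.
  + by split=> z c u v; rewrite !D.
  + by rewrite witt_mulU !iU Wa_mulU.
- apply: (bilinear_ext (F := fun x y => witt_incl (witt_br x y))
    (G := fun x y => Wa_br a (witt_incl x) (witt_incl y))) => [||n m].
  + by split=> z c u v; rewrite !D.
  + by split=> z c u v; rewrite !D.
  + by rewrite witt_brU iZ !iU Wa_brU.
Qed.

End Algebras.

(* Main.v *)
Require Import Defs.
From mathcomp Require Import all_boot all_order all_algebra.
From mathcomp Require Import reals complex.
From mathcomp Require Import monalg.

Import GRing.Theory.

Local Open Scope ring_scope.
Local Open Scope complex_scope.

(** Let [D] be a delta-derivation of a commutative product with unit [1].
    Applying [D] to [1 * 1 = 1] gives [D 1 = 2 delta D 1], so [D 1 = 0] unless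
    [delta = 1/2]. Once [D 1 = 0], applying [D] to [1 * x = x] gives
    [D x = delta D x], so [D = 0] unless [delta = 1]. This is
    [unital_delta_derivation]; it settles both algebras because [L_0] is the
    unit of both commutative products. *)

Lemma unital_delta_derivation (K : fieldType) (A : transposedPoissonAlg K)
    (e : A) (delta : K) (D : {linear A -> A}) :
  left_id e (@tp_mul K A) -> delta_derivation delta D -> nontrivial D ->
  delta = 1 \/ delta = 2%:R^-1.
Proof.
move=> mul1x [Dmul _] [x /eqP Dx_neq0].
have mulx1 y : tp_mul y e = y by rewrite tp_mulC mul1x.
have /eqP : (1 - delta * 2%:R) *: D e = 0.
  have := Dmul e e; rewrite mul1x mul1x mulx1 -mulr2n -scaler_nat scalerA.
  by move=> De; rewrite scalerBl scale1r -De subrr.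
rewrite scaler_eq0 subr_eq0 => /orP [/eqP delta2|/eqP De0].
  by right; rewrite (@mulr1_eq _ 2%:R delta) // mulrC.
have /eqP : (1 - delta) *: D x = 0.
  have mul0x : tp_mul 0 x = 0 :> A := bil0l (@tp_mul_bilinear K A) x.
  have := Dmul e x; rewrite De0 mul0x !mul1x add0r => Dx.
  by rewrite scalerBl scale1r -Dx subrr.
by rewrite scaler_eq0 (negPf Dx_neq0) orbF subr_eq0 => /eqP <-; left.
Qed.

Lemma witt_mul_left_id (C : numFieldType) :
  left_id << 0 >> (@witt_mul C).
Proof.
have [_ mul_linear] := witt_mul_bilinear C.
apply: linear_ext => [||n]; [exact: mul_linear | by [] |].
by rewrite witt_mulU add0r.
Qed.

Lemma Wa_mul_left_id (C : numFieldType) :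
  left_id << (inl 0 : wbasis) >> (@Wa_mul C).
Proof.
have [_ mul_linear] := Wa_mul_bilinear C.
apply: linear_ext => [||[n|m]]; [exact: mul_linear | by [] | |];
  by rewrite Wa_mulU /= add0r.
Qed.

Theorem proposition2p20 (R : realType) (a delta : R[i]) :
  ((exists D : {linear W_minus1 a -> W_minus1 a},
      delta_derivation delta D /\ nontrivial D) ->
   delta = 1 \/ delta = 2%:R^-1) /\
  ((exists D : {linear witt R[i] -> witt R[i]},
      delta_derivation delta D /\ nontrivial D) ->
   delta = 1 \/ delta = 2%:R^-1).
Proof.
split=> [] [D [derD ntD]].
- exact: (@unital_delta_derivation _ (W_minus1 a) _ _
            D (@Wa_mul_left_id _) derD ntD).
- exact: (@unital_delta_derivation _ (witt R[i]) _ _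
            D (@witt_mul_left_id _) derD ntD).
Qed.
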